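(* Let $X$ be a Banach space with property $(\beta)$. Then $c_0$ is not a uniform quotient of $X$, and $c_0$ is not a Lipschitz quotient of any subset of $X$ (the subset being equipped with the metric induced by the norm of $X$).
   Context: All balls are closed. A map $T:S\to Y$ between metric spaces is called co-uniformly continuous if for every $\varepsilon>0$ there exists $\delta>0$ such that for every $x\in S$, $B(Tx,\delta)\subseteq T(B(x,\varepsilon))$; it is called co-Lipschitz if $\delta$ can be chosen linear in $\varepsilon$, i.e. there is $c>0$ such that $B(Tx,cr)\subseteq T(B(x,r))$ for all $x\in S$ and all $r>0$ (balls are taken in the respective metric spaces $S$ and $Y$). $Y$ is a uniform quotient (resp. Lipschitz quotient) of $S$ if there is a surjective map $T:S\to Y$ that is both uniformly continuous and co-uniformly continuous (resp. both Lipschitz and co-Lipschitz); $T$ is not assumed linear. For a sequence $(x_n)_n$ in a Banach space, $\mathrm{sep}(\{x_n\})=\inf\{\|x_n-x_m\|: n\ne m\}$. A Banach space $X$ with closed unit ball $B_X$ has property $(\beta)$ (of Rolewicz) if for every $\varepsilon>0$ there exists $\delta>0$ such that for every $x\in B_X$ and every sequence $(x_n)_n\subseteq B_X$ with $\mathrm{sep}(\{x_n\})\ge\varepsilon$, there exists an index $i$ such that $\left\|\frac{x_i+x}{2}\right\|\le 1-\delta$. *)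

(* Defs.v *)
From HB Require Import structures.
From mathcomp Require Import all_boot all_order all_algebra.
From mathcomp Require Import all_classical all_reals all_analysis.

Set Implicit Arguments.
Unset Strict Implicit.
Unset Printing Implicit Defensive.

Import Order.TTheory GRing.Theory Num.Theory.
Import numFieldNormedType.Exports.

Local Open Scope classical_set_scope.
Local Open Scope ring_scope.

Section c0.
Context {R : realType}.

Definition null_seq : {pred nat -> R^o} :=
  fun u => `[< u @ \oo --> (0 : R^o) >].

Lemma null_seqP (u : nat -> R^o) :
  reflect (u @ \oo --> (0 : R^o)) (u \in null_seq).
Proof. exact: asboolP. Qed.

Lemma null_seq_submod_closed : submod_closed null_seq.
Proof.
split; first by apply/null_seqP; exact: cvg_cst.
move=> a u v /null_seqP u0 /null_seqP v0; apply/null_seqP.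
have -> : (0 : R^o) = a *: (0 : R^o) + 0 by rewrite scaler0 addr0.
by apply: cvgD => //; exact: cvgZl_tmp.
Qed.

HB.instance Definition _ :=
  GRing.isSubmodClosed.Build R (nat -> R^o) null_seq null_seq_submod_closed.

Record c0 := C0 { c0_seq :> nat -> R^o ; _ : c0_seq \in null_seq }.

HB.instance Definition _ := [isSub for c0_seq].
HB.instance Definition _ := [Choice of c0 by <:].
HB.instance Definition _ := [SubChoice_isSubLmodule of c0 by <:].

Lemma c0_cvg (u : c0) : u n @[n --> \oo] --> (0 : R^o).
Proof. by case: u => u /= /null_seqP. Qed.

Definition c0_norm (u : c0) : R := sup (range (fun n => `|u n|)).

Lemma c0_has_sup (u : c0) : has_sup (range (fun n => `|u n|)).
Proof.
split; first by exists `|u 0%N|, 0%N.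
have /cvg_seq_bounded/pinfty_ex_gt0[M _ uM] : cvg (c0_seq u n @[n --> \oo]).
  by apply/cvg_ex; exists 0; exact: c0_cvg.
by exists M => _ [n _ <-]; exact: uM.
Qed.

Lemma ler_c0_norm (u : c0) n : `|u n| <= c0_norm u.
Proof. by apply: (ub_le_sup (c0_has_sup u).2); exists n. Qed.

Lemma c0_norm_le (u : c0) (M : R) :
  (forall n, `|u n| <= M) -> c0_norm u <= M.
Proof.
by move=> uM; apply: (ge_sup (c0_has_sup u).1) => _ [n _ <-].
Qed.

Lemma c0_ler_normD (u v : c0) : c0_norm (u + v) <= c0_norm u + c0_norm v.
Proof.
apply: c0_norm_le => n; apply: (le_trans (ler_normD (u n) (v n))).
by rewrite lerD// ler_c0_norm.
Qed.

Lemma c0_normZ_le (a : R) (u : c0) : c0_norm (a *: u) <= `|a| * c0_norm u.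
Proof.
apply: c0_norm_le => n; rewrite -[X in _ <= X]/(`|a| * c0_norm u).
by rewrite [X in `|X|]/(a * u n) normrM ler_wpM2l// ler_c0_norm.
Qed.

Lemma c0_normrZ (a : R) (u : c0) : c0_norm (a *: u) = `|a| * c0_norm u.
Proof.
apply/eqP; rewrite eq_le c0_normZ_le/=.
have [->|a0] := eqVneq a 0.
  by rewrite normr0 mul0r (le_trans _ (ler_c0_norm _ 0%N)).
rewrite -ler_pdivlMl ?normr_gt0// -normfV.
by rewrite (le_trans _ (c0_normZ_le _ _))// scalerA mulVf// scale1r.
Qed.

Lemma c0_normr0_eq0 (u : c0) : c0_norm u = 0 -> u = 0.
Proof.
move=> u0; apply/val_inj/funext => n /=; apply/normr0_eq0/eqP.
by rewrite eq_le normr_ge0 andbT -u0 ler_c0_norm.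
Qed.

HB.instance Definition _ :=
  Lmodule_isNormed.Build R c0 c0_ler_normD c0_normrZ c0_normr0_eq0.

End c0.
Arguments c0 : clear implicits.

(* A subset A of a normed space X carries the induced metric: its closed balls
   are the traces on A of the closed balls of X. Maps defined on A are total
   maps X -> Y of which only the restriction to A matters. *)
Section quotients.
Context {R : realType}.

Definition co_uniformly_continuous {X Y : normedModType R} (A : set X)
    (T : X -> Y) :=
  forall eps : R, 0 < eps -> exists2 delta : R, 0 < delta &
    forall x, A x ->
      closed_ball_ Num.norm (T x) delta `<=`
      T @` (A `&` closed_ball_ Num.norm x eps).

Definition co_lipschitz {X Y : normedModType R} (A : set X) (T : X -> Y) :=
  exists2 c : R, 0 < c &
    forall x, A x -> forall r : R, 0 < r ->
      closed_ball_ Num.norm (T x) (c * r) `<=`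
      T @` (A `&` closed_ball_ Num.norm x r).

Definition uniform_quotient (X Y : normedModType R) :=
  exists T : X -> Y, [/\ set_surj setT setT T, unif_continuous T &
    co_uniformly_continuous setT T].

Definition lipschitz_quotient {X : normedModType R} (A : set X)
    (Y : normedModType R) :=
  exists T : X -> Y, [/\ set_surj A setT T, [lipschitz T x | x in A] &
    co_lipschitz A T].

End quotients.

Section property_beta.
Context {R : realType}.

Definition sep {X : normedModType R} (u : nat -> X) : R :=
  inf [set `|u p.1 - u p.2| | p in [set p : nat * nat | p.1 <> p.2]].

Definition property_beta (X : normedModType R) :=
  forall eps : R, 0 < eps -> exists2 delta : R, 0 < delta &
    forall (x : X) (u : nat -> X),
      closed_ball_ Num.norm 0 1 x ->
      (forall n, closed_ball_ Num.norm 0 1 (u n)) ->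
      eps <= sep u ->
      exists i, `|2^-1 *: (u i + x)| <= 1 - delta.

End property_beta.

(* Main.v *)
(* Coarsely, both kinds of quotient map T satisfy |Tx - Ty| <= L|x - y| + K and,
   at large scales r, B(Tx, cr) is contained in T(B(x, r)). Write a target of Tx
   at distance 3a as Tx + 3h with |h| <= a = c rho. In c0 there are vectors v_i,
   far out and a/2-separated, with |h + v_i|, |h - v_i| <= a. Lift in three steps
   of length rho along Tx, Tx + h, Tx + 2h + v_i, Tx + 3h: the lifts z_i of the
   third points are separated, so by property (beta) some z_i lies within
   2 rho (1 - delta) of x, and the total length 3 rho is shortened by a factor
   q < 1. Hence c / q is also admissible, with the same q at each iteration,
   which contradicts the bound c <= 2L. *)
Require Import Defs.
From mathcomp Require Import all_boot all_order all_algebra.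
From mathcomp Require Import all_classical all_reals all_analysis.
From mathcomp Require Import ring lra.

Set Implicit Arguments.
Unset Strict Implicit.
Unset Printing Implicit Defensive.

Import Order.TTheory GRing.Theory Num.Theory.
Import numFieldNormedType.Exports.

Local Open Scope classical_set_scope.
Local Open Scope ring_scope.

(** * Separated perturbations in $c_0$ *)

Section c0_perturbations.
Context {R : realType}.

Lemma unit_seq_null (n : nat) :
  (fun k => ((k == n)%:R : R^o)) \in @null_seq R.
Proof.
apply/null_seqP; apply: cvg_near_cst; exists n.+1 => // k /= nk.
by rewrite gtn_eqF.
Qed.

Definition unit_c0 n : c0 R := C0 (unit_seq_null n).

(** As [h] tends to 0, its coordinates from some [N] on are at most a/2 in modulus, which leaves
    room there for a bump of height a/2 of either sign. *)
Lemma c0_separated_perturbations (a : R) (h : c0 R) : 0 < a -> `|h| <= a ->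
  exists v : nat -> c0 R, [/\ forall i, `|h + v i| <= a,
    forall i, `|h - v i| <= a & forall i j, i <> j -> a / 2 <= `|v i - v j|].
Proof.
move=> a0 ha.
have hn n : `|h n| <= a by exact: le_trans (ler_c0_norm h n) ha.
have [N _ hN] : \forall n \near \oo, `|h n| <= a / 2.
  have /cvgrPdist_le/(_ (a / 2))[|N _ hN] := c0_cvg h; first by lra.
  by exists N => // n /hN; rewrite sub0r normrN.
exists (fun i => (a / 2) *: unit_c0 (N + i)); split=> [i|i|i j ij].
- apply: c0_norm_le => n; have := hn n.
  rewrite -[X in _ -> `|X| <= _]/(h n + a / 2 * (n == (N + i)%N)%:R).
  have [->|_] := eqVneq n (N + i)%N; last by rewrite mulr0 addr0.
  rewrite mulr1; have := hN (N + i)%N (leq_addr _ _); rewrite !ler_norml; lra.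
- apply: c0_norm_le => n; have := hn n.
  rewrite -[X in _ -> `|X| <= _]/(h n - a / 2 * (n == (N + i)%N)%:R).
  have [->|_] := eqVneq n (N + i)%N; last by rewrite mulr0 subr0.
  rewrite mulr1; have := hN (N + i)%N (leq_addr _ _); rewrite !ler_norml; lra.
- apply: le_trans (ler_c0_norm _ (N + i)%N).
  rewrite -[X in _ <= `|X|]/(a / 2 * ((N + i)%N == (N + i)%N)%:R
                             - a / 2 * ((N + i)%N == (N + j)%N)%:R).
  rewrite eqxx eqn_add2l; have /eqP/negbTE-> := ij.
  by rewrite mulr0 subr0 mulr1 ler_norm.
Qed.

Lemma c0_norm_surj (a : R) : 0 <= a -> exists u : c0 R, `|u| = a.
Proof.
move=> a0; exists (a *: unit_c0 0); apply/eqP; rewrite eq_le; apply/andP; split.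
  apply: c0_norm_le => n.
  rewrite -[X in `|X| <= _]/(a * (n == 0%N)%:R).
  by case: (n == 0%N); rewrite ?mulr1 ?mulr0 ?normr0// ger0_norm.
apply: le_trans (ler_c0_norm _ 0%N).
by rewrite -[X in _ <= `|X|]/(a * 1) mulr1 ler_norm.
Qed.

End c0_perturbations.

(** Property (beta) rescaled around the middle point [m]: (x - m)/rho and (m - z_i)/rho lie in the
    unit ball, and their sum is (x - z_i)/rho. *)
Lemma beta_fork (R : realType) (X : normedModType R) : property_beta X ->
  forall eps : R, 0 < eps -> exists2 delta : R, 0 < delta <= 1 &
    forall (rho : R) (x m : X) (z : nat -> X), 0 < rho -> `|x - m| <= rho ->
      (forall i, `|m - z i| <= rho) ->
      (forall i j, i <> j -> eps * rho <= `|z i - z j|) ->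
      exists i, `|x - z i| <= 2 * (1 - delta) * rho.
Proof.
move=> hX eps /hX[d d0 hd].
have mdP : Num.min d 1 <= d by rewrite ge_min lexx.
(* The cap at 1 will keep the factor 1 - 2 delta/3 positive. *)
exists (Num.min d 1); first by rewrite lt_min d0 ltr01 ge_min lexx orbT.
move=> rho x m z rho0 xm mz zsep.
have scale (u : X) : `|rho^-1 *: u| = rho^-1 * `|u|.
  by rewrite normrZ gtr0_norm// invr_gt0.
have ball1 (u : X) : `|u| <= rho -> closed_ball_ Num.norm 0 1 (rho^-1 *: u).
  by move=> urho; rewrite /closed_ball_/= sub0r normrN scale ler_pdivrMl// mulr1.
have [|||i] := hd (rho^-1 *: (x - m)) (fun i => rho^-1 *: (m - z i)).
- exact: ball1.
- by move=> i; apply: ball1.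
- apply: lb_le_inf; first by eexists; exists (0%N, 1%N).
  move=> _ [[i j] /= ij <-]; rewrite -scalerBr scale ler_pdivlMl// mulrC.
  by rewrite opprB addrC addrA subrK distrC; exact: zsep.
rewrite -scalerDr addrC addrA subrK normrZ scale gtr0_norm ?invr_gt0// => xz.
exists i; rewrite -ler_pdivrMr//; move: xz; rewrite mulrC; lra.
Qed.

(** The threshold [r0] is existential, so it may grow each time [c] is improved. *)
Definition coarse_co_lipschitz (R : realType) (X Y : normedModType R)
    (A : set X) (T : X -> Y) (c : R) :=
  exists2 r0 : R, 0 <= r0 & forall x, A x -> forall r, r0 < r ->
    closed_ball_ Num.norm (T x) (c * r) `<=`
    T @` (A `&` closed_ball_ Num.norm x r).

(** * Improving the coarse co-Lipschitz constant *)

Section improvement.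
Context {R : realType} {X : normedModType R} (hX : property_beta X).
Context (A : set X) (T : X -> c0 R) (L K : R).
Hypotheses (L0 : 0 < L) (K0 : 0 <= K).
Hypothesis TL : forall x y, A x -> A y -> `|T x - T y| <= L * `|x - y| + K.

(** The separation b/(4L) involves only the lower bound [b] of [c], so one [q] serves all
    iterations. *)
Lemma coarse_co_lipschitz_improve (b : R) : 0 < b ->
  exists2 q : R, 0 < q < 1 &
    forall c, b <= c -> coarse_co_lipschitz A T c ->
      coarse_co_lipschitz A T (c / q).
Proof.
move=> b0; have eps0 : 0 < b / (4 * L) by rewrite divr_gt0// mulr_gt0.
have [d /andP[d0 d1] fork] := beta_fork hX eps0.
(* The shortened path has length 2(1 - d) rho + rho = 3 q rho. *)
pose q := 1 - 2 / 3 * d; have q0 : 0 < q by rewrite /q; lra.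
exists q; first by rewrite q0/= /q; lra.
move=> c bc [r0 r00 co].
have c0 : 0 < c by lra.
have Kc : 0 <= 4 * K / c by rewrite divr_ge0 ?mulr_ge0// ltW.
(* Since q < 1, rho = r'/(3q) is larger than r'/3, hence than both [r0] and 4K/c. *)
exists (3 * (r0 + 4 * K / c)); first by lra.
move=> x Ax r' rr' y; rewrite /closed_ball_/= => xy.
pose rho := r' / q / 3.
have r'E : r' = 3 * q * rho by rewrite /rho; field; lra.
have qrho : r' <= 3 * rho.
  by rewrite /rho mulrCA divff// mulr1 ler_pdivlMr// /q; nra.
have rho_r0 : r0 < rho by lra.
have rho0 : 0 < rho by lra.
have Krho : 4 * K <= c * rho.
  by rewrite -ler_pdivrMl// mulrC; lra.
pose h := 3^-1 *: (y - T x).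
have hrho : `|h| <= c * rho.
  rewrite /h normrZ gtr0_norm// distrC; move: xy.
  rewrite r'E (_ : c / q * (3 * q * rho) = 3 * (c * rho)); last by field; lra.
  lra.
have yE : y = T x + h + h + h.
  rewrite -!addrA -mulr2n -mulrS -scaler_nat /h scalerA divff// scale1r.
  by rewrite addrC subrK.
have [v [hDv hBv vsep]] := c0_separated_perturbations (mulr_gt0 c0 rho0) hrho.
have [|m [Am xm] Tm] := co _ Ax _ rho_r0 (T x + h).
  by rewrite /closed_ball_/= opprD addNKr normrN.
have /choice[z zP] i :
    exists z, [/\ A z, `|m - z| <= rho & T z = T x + h + h + v i].
  have [|z [Az mz] Tz] := co _ Am _ rho_r0 (T x + h + h + v i); last by exists z.
  by rewrite /closed_ball_/= Tm -(addrA (T x + h)) opprD addNKr normrN.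
have [||||i xz] := fork rho x m z => //.
- by move=> i; case: (zP i).
(* The images are at least c rho/2 apart and [K] is at most c rho/4, so L |z_i - z_j| is at least c
   rho/4, hence at least b rho/4. *)
- move=> i j ij; have [Ai _ Ti] := zP i; have [Aj _ Tj] := zP j.
  have := TL Ai Aj; rewrite Ti Tj opprD addrACA subrr add0r.
  have := vsep _ _ ij => /le_trans/[apply] vL.
  rewrite mulrAC ler_pdivrMr; last by rewrite mulr_gt0.
  have : b * rho <= c * rho by rewrite ler_wpM2r// ltW.
  lra.
have [Az _ Tz] := zP i.
have [|w [Aw zw] Tw] := co _ Az _ rho_r0 y.
  rewrite /closed_ball_/= Tz yE opprD addrACA.
  by rewrite subrr add0r -normrN opprB.
exists w => //; split=> //=; rewrite /closed_ball_/=.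
rewrite (le_trans (ler_distD (z i) _ _))// (le_trans (lerD xz zw))//.
by rewrite r'E /q; lra.
Qed.

(** A point at distance exactly c r from Tx lifts to within r of x, so c r <= L r + K, and K <= L r
    for large r. *)
Lemma coarse_co_lipschitz_le (c : R) : A !=set0 -> 0 < c ->
  coarse_co_lipschitz A T c -> c <= 2 * L.
Proof.
move=> [x Ax] c0 [r0 r00 co].
have KL : 0 <= K / L by rewrite divr_ge0// ltW.
pose r := r0 + K / L + 1; have r_gt0 : 0 < r by rewrite /r; lra.
have [u uE] := c0_norm_surj (mulr_ge0 (ltW c0) (ltW r_gt0)).
have [||w [Aw xw] Tw] := co _ Ax r _ (T x + u).
- by rewrite /r; lra.
- by rewrite /closed_ball_/= opprD addNKr normrN uE.
have := TL Ax Aw; rewrite Tw opprD addNKr normrN uE => crL.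
have xwL : L * `|x - w| <= L * r by rewrite ler_pM2l.
have KLr : K <= L * r by rewrite -ler_pdivrMl// mulrC /r; lra.
by rewrite -(ler_pM2r r_gt0); lra.
Qed.

Lemma not_coarse_co_lipschitz_c0 (c : R) : A !=set0 -> 0 < c ->
  ~ coarse_co_lipschitz A T c.
Proof.
move=> A0 c0 coc.
have [q /andP[q0 q1] improve] := coarse_co_lipschitz_improve c0.
have iterate n : c <= c / q ^+ n /\ coarse_co_lipschitz A T (c / q ^+ n).
  elim: n => [|n [cn con]]; first by rewrite expr0 divr1.
  rewrite exprSr invfM mulrA; split; last exact: improve.
  by rewrite ler_pdivlMr//; nra.
have q_lt1 : `|q| < 1 by rewrite gtr0_norm.
(* Once q^N < c/(2L), the constant c/q^N exceeds 2L. *)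
have [|N _ qN] := (cvgrPdist_lt _ _).1 (cvg_expr q_lt1) (c / (2 * L)).
  by rewrite divr_gt0// mulr_gt0.
have qN0 : 0 < q ^+ N by rewrite exprn_gt0.
have := qN N (leqnn N); rewrite /= sub0r normrN gtr0_norm//.
have [cN /(coarse_co_lipschitz_le A0)] := iterate N.
move=> /(_ (lt_le_trans c0 cN)); rewrite ler_pdivrMr// ltr_pdivlMr ?mulr_gt0//.
by lra.
Qed.

End improvement.

(** * Chaining from one fixed scale to large scales *)

Lemma norm_split (R : realType) (X : normedModType R) (u : X) (d : R) n :
  0 < d -> `|u| <= n.+1%:R * d ->
  exists2 v : X, `|v| <= d & `|u - v| <= n%:R * d.
Proof.
move=> d0 un; have n0 : 0 < n.+1%:R :> R by rewrite ltr0n.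
exists (n.+1%:R^-1 *: u).
  by rewrite normrZ gtr0_norm ?invr_gt0// ler_pdivrMl.
rewrite -[X in `|X - _|]scale1r -scalerBl.
have -> : 1 - n.+1%:R^-1 = n%:R * n.+1%:R^-1 :> R.
  apply: (mulIf (lt0r_neq0 n0)).
  by rewrite mulrBl mulfVK ?lt0r_neq0// mul1r mulVf ?lt0r_neq0// -natr1 addrK.
rewrite normrZ ger0_norm ?divr_ge0// -mulrA ler_wpM2l//.
by rewrite ler_pdivrMl.
Qed.

Lemma unif_continuous_coarse_lipschitz (R : realType) (X Y : normedModType R)
    (T : X -> Y) : unif_continuous T ->
  exists2 L : R, 0 < L & forall x y, `|T x - T y| <= L * `|x - y| + 1.
Proof.
move=> /unif_continuousP/(_ 1 ltr01)[d d0 dT].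
(* Steps of length d/2 stay strictly inside the open ball of radius d. *)
have d20 : 0 < d / 2 by rewrite divr_gt0.
have chain n : forall x y, `|x - y| <= n%:R * (d / 2) -> `|T x - T y| <= n%:R.
  elim: n => [|n IH] x y xy.
    move: xy; rewrite mul0r normr_le0 subr_eq0 => /eqP->.
    by rewrite subrr normr0.
  have [v vd xyv] := norm_split d20 xy.
  rewrite (le_trans (ler_distD (T (x - v)) _ _))// mulrS lerD//.
    have := dT (x, x - v); rewrite -!ball_normE /= => /(_ _)/ltW; apply.
    by rewrite opprB addrC subrK (le_lt_trans vd)//; lra.
  by apply: IH; rewrite addrAC.
exists (2 / d); first by rewrite divr_gt0.
move=> x y; have t0 : 0 <= 2 / d * `|x - y|.
  by rewrite mulr_ge0 // divr_ge0 // ltW.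
rewrite (le_trans (chain (Num.truncn (2 / d * `|x - y|)).+1 x y _))//.
  rewrite -ler_pdivrMr// (_ : `|x - y| / (d / 2) = 2 / d * `|x - y|);
    last by field; lra.
  by rewrite ltW// truncnS_gt.
by rewrite -natr1 lerD2r truncn_le.
Qed.

(** The segment in the target is cut into steps of length at most [d], each lifted at cost at most
    1. *)
Lemma co_uniformly_continuous_coarse (R : realType) (X Y : normedModType R)
    (T : X -> Y) : co_uniformly_continuous setT T ->
  exists2 c : R, 0 < c & coarse_co_lipschitz setT T c.
Proof.
move=> /(_ 1 ltr01)[d d0 dT].
have chain n : forall x y, `|T x - y| <= n%:R * d ->
    exists2 w, `|x - w| <= n%:R & T w = y.
  elim: n => [|n IH] x y xy.
    exists x; first by rewrite subrr normr0.
    by move: xy; rewrite mul0r normr_le0 subr_eq0 => /eqP.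
  have [v vd xyv] := norm_split d0 xy.
  have [|w [_ xw] Tw] := dT x Logic.I (T x - v).
    by rewrite /closed_ball_/= opprB addrC subrK.
  have [|z wz Tz] := IH w y; first by rewrite Tw addrAC.
  exists z => //; rewrite (le_trans (ler_distD w _ _))// mulrS lerD//.
(* For r > 1, halving absorbs the rounding: r <= 2 [Num.truncn r]. *)
exists (d / 2); first by rewrite divr_gt0.
exists 1 => // x _ r r1 y; rewrite /closed_ball_/= => xy.
have r0 : 0 <= r by lra.
have [|w xw Tw] := chain (Num.truncn r) x y; last first.
  by exists w => //; split=> //=; rewrite (le_trans xw)// truncn_le.
apply: le_trans xy _; rewrite mulrAC -mulrA mulrC ler_pM2r//.
have := truncnS_gt r; rewrite -natr1.
have : 1 <= (Num.truncn r)%:R :> R by rewrite ler1n truncn_gt0 ltW.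
lra.
Qed.

Theorem theorem4p3 (R : realType) (X : completeNormedModType R)
    (hX : property_beta X) :
  ~ uniform_quotient X (c0 R) /\
  forall A : set X, ~ lipschitz_quotient A (c0 R).
Proof.
split=> [[T [_ /unif_continuous_coarse_lipschitz[L L0 TL]]]|A [T [AT TL]]].
  move=> /co_uniformly_continuous_coarse[c c0 coc].
  by apply: (not_coarse_co_lipschitz_c0 hX L0 ler01 _ _ c0 coc) => //; exists 0.
move=> [c c0 coc].
have A0 : A !=set0 by have [x Ax _] := AT 0 Logic.I; exists x.
(* Here both estimates are linear at every scale on [A], so [K] and [r0] are taken to be 0. *)
have [L L0 {}TL] := pinfty_ex_gt0 TL.
apply: (not_coarse_co_lipschitz_c0 hX L0 (lexx 0) _ A0 c0).
  by move=> x y Ax Ay; rewrite addr0; exact: (TL (x, y)).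
by exists 0.
Qed.
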